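(* Let $k\le l\le n$, $\mathbf{A}\in\operatorname{Gr}(k,n)$ and $\mathbf{B}\in\operatorname{Gr}(l,n)$. Then $$d^{*}_{\operatorname{Gr}(k,n)}\bigl(\mathbf{A},\Omega_{-}(\mathbf{B})\bigr) = d^{*}_{\operatorname{Gr}(l,n)}\bigl(\mathbf{B},\Omega_{+}(\mathbf{A})\bigr)$$ for each $* = \alpha,\beta,\kappa,\phi,\mu,\rho,\pi,\sigma$. Writing $\theta_i=\theta_i(\mathbf{A},\mathbf{B})$, $i=1,\dots,k$, for the principal angles, their common value $\delta^{*}(\mathbf{A},\mathbf{B})$ is given by $$\delta^{\alpha}(\mathbf{A},\mathbf{B})=\theta_k,\qquad \delta^{\beta}(\mathbf{A},\mathbf{B})=\Bigl(1-\prod_{i=1}^k\cos^2\theta_i\Bigr)^{1/2},$$ $$\delta^{\kappa}(\mathbf{A},\mathbf{B})=\Bigl(\sum_{i=1}^k\sin^2\theta_i\Bigr)^{1/2},\qquad \delta^{\phi}(\mathbf{A},\mathbf{B})=\cos^{-1}\Bigl(\prod_{i=1}^k\cos\theta_i\Bigr),$$ $$\delta^{\mu}(\mathbf{A},\mathbf{B})=\Bigl(\log\prod_{i=1}^k\frac{1}{\cos^2\theta_i}\Bigr)^{1/2},\qquad \delta^{\rho}(\mathbf{A},\mathbf{B})=2\Bigl(\sum_{i=1}^k\sin^2(\theta_i/2)\Bigr)^{1/2},$$ $$\delta^{\pi}(\mathbf{A},\mathbf{B})=\sin\theta_k,\qquad \delta^{\sigma}(\mathbf{A},\mathbf{B})=2\sin(\theta_k/2),$$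 or more generally by the same formulas with $\min(k,l)$ in place of the index $k$ when $k\le l$ is not required (the roles of $\mathbf{A}$ and $\mathbf{B}$ being interchanged if $k>l$).
   Context: $\operatorname{Gr}(k,n)$ is the Grassmannian of $k$-dimensional linear subspaces of $\mathbb{R}^n$; $k,l,n$ are positive integers. Principal angles: for subspaces $\mathbf{A},\mathbf{B}$ of $\mathbb{R}^n$ of dimensions $k,l$, let $A \in \mathbb{R}^{n\times k}$, $B\in\mathbb{R}^{n\times l}$ have as columns orthonormal bases of $\mathbf{A}$, $\mathbf{B}$. The principal angles are $\theta_i(\mathbf{A},\mathbf{B}) = \cos^{-1}\sigma_i(A^{\mathsf T}B)\in[0,\pi/2]$, $i=1,\dots,\min(k,l)$, where $\sigma_1\ge\sigma_2\ge\cdots$ are the singular values of $A^{\mathsf T}B$; thus $\theta_1\le\theta_2\le\cdots$. For $\mathbf{A},\mathbf{B}\in\operatorname{Gr}(k,n)$ of equal dimension $k$ with principal angles $\theta_1\le\dots\le\theta_k$, define: $d^{\alpha}_{\operatorname{Gr}(k,n)}(\mathbf{A},\mathbf{B})=\theta_k$ (Asimov); $d^{\beta}_{\operatorname{Gr}(k,n)}(\mathbf{A},\mathbf{B})=(1-\prod_{i=1}^k\cos^2\theta_i)^{1/2}$ (Binet--Cauchy); $d^{\kappa}_{\operatorname{Gr}(k,n)}(\mathbf{A},\mathbf{B})=(\sum_{i=1}^k\sin^2\theta_i)^{1/2}$ (chordal); $d^{\phi}_{\operatorname{Gr}(k,n)}(\mathbf{A},\mathbf{B})=\cos^{-1}(\prod_{i=1}^k\cos\theta_i)$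 (Fubini--Study); $d^{\mu}_{\operatorname{Gr}(k,n)}(\mathbf{A},\mathbf{B})=(\log\prod_{i=1}^k 1/\cos^2\theta_i)^{1/2}$ (Martin; equal to $+\infty$ if some $\theta_i=\pi/2$); $d^{\rho}_{\operatorname{Gr}(k,n)}(\mathbf{A},\mathbf{B})=2(\sum_{i=1}^k\sin^2(\theta_i/2))^{1/2}$ (Procrustes); $d^{\pi}_{\operatorname{Gr}(k,n)}(\mathbf{A},\mathbf{B})=\sin\theta_k$ (projection); $d^{\sigma}_{\operatorname{Gr}(k,n)}(\mathbf{A},\mathbf{B})=2\sin(\theta_k/2)$ (spectral). For $\mathbf{A}\in\operatorname{Gr}(k,n)$, $\mathbf{B}\in\operatorname{Gr}(l,n)$ with $k\le l\le n$: $\Omega_{+}(\mathbf{A}) = \{\mathbf{X}\in\operatorname{Gr}(l,n): \mathbf{A}\subseteq\mathbf{X}\}$ and $\Omega_{-}(\mathbf{B}) = \{\mathbf{Y}\in\operatorname{Gr}(k,n): \mathbf{Y}\subseteq\mathbf{B}\}$. For a point $x$ and a set $S$, $d^*(x,S)=\inf\{d^*(x,y):y\in S\}$. *)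

(* Defs.v *)
From mathcomp Require Import all_boot all_order all_algebra.
From mathcomp Require Import all_classical all_reals all_analysis.
From mathcomp Require Import polyrcf.

Set Implicit Arguments.
Unset Strict Implicit.
Unset Printing Implicit Defensive.

Import Order.TTheory GRing.Theory Num.Theory.
Import numFieldNormedType.Exports.

Local Open Scope classical_set_scope.
Local Open Scope ring_scope.

Record Gr (R : realType) (k n : nat) := MkGr {
  gr_space :> {vspace 'cV[R]_n};
  dim_gr : \dim gr_space = k }.

(* Real eigenvalues of [S] in nonincreasing order, repeated according to their
   algebraic multiplicity; for symmetric [S] these are all its eigenvalues. *)
Definition real_eigenvalues (R : realType) (k : nat) (S : 'M[R]_k) : seq R :=
  sort >=%R (flatten [seq nseq (mup x (char_poly S)) x
                     | x <- rootsR (char_poly S)]).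

Definition singular_values (R : realType) (k l : nat) (M : 'M[R]_(k, l)) :
    seq R :=
  take (minn k l) [seq Num.sqrt x | x <- real_eigenvalues (M^T *m M)].

Definition orthonormal_basis (R : realType) (k n : nat)
    (V : {vspace 'cV[R]_n}) (A : 'M[R]_(n, k)) : Prop :=
  A^T *m A = 1%:M /\ <<[seq col j A | j : 'I_k]>>%VS = V.

(* An arbitrary orthonormal basis: see [orthonormal_basis_of_gr] and
   [principal_angleE] for its existence and the independence of the choice. *)
Definition gr_basis (R : realType) (k n : nat) (V : Gr R k n) : 'M[R]_(n, k) :=
  xget 0 [set A | orthonormal_basis V A].

(* Indices start at 0: the angles theta_1 <= ... <= theta_min(k,l) are the
   values at i = 0, ..., (minn k l).-1. *)
Definition principal_angle (R : realType) (k l n : nat)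
    (V : Gr R k n) (W : Gr R l n) (i : nat) : R :=
  acos (singular_values ((gr_basis V)^T *m gr_basis W))`_i.

Inductive gr_metric : Set :=
  | Asimov | BinetCauchy | Chordal | FubiniStudy
  | Martin | Procrustes | Projection | Spectral.

(* [theta 0 <= ... <= theta m.-1] are [m] angles in [0, pi / 2]; only the
   Martin distance can be infinite, when one of them is [pi / 2]. *)
Definition of_angles (R : realType) (d : gr_metric) (m : nat)
    (theta : nat -> R) : \bar R :=
  match d with
  | Asimov => (theta m.-1)%:E
  | BinetCauchy => (Num.sqrt (1 - \prod_(i < m) cos (theta i) ^+ 2))%:E
  | Chordal => (Num.sqrt (\sum_(i < m) sin (theta i) ^+ 2))%:E
  | FubiniStudy => (acos (\prod_(i < m) cos (theta i)))%:E
  | Martin =>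
      if [exists i : 'I_m, theta i == pi / 2] then +oo%E
      else (Num.sqrt (ln (\prod_(i < m) (1 / cos (theta i) ^+ 2))))%:E
  | Procrustes => (2 * Num.sqrt (\sum_(i < m) sin (theta i / 2) ^+ 2))%:E
  | Projection => (sin (theta m.-1))%:E
  | Spectral => (2 * sin (theta m.-1 / 2))%:E
  end.

Definition gr_dist (R : realType) (d : gr_metric) (k n : nat)
    (V W : Gr R k n) : \bar R :=
  of_angles d k (principal_angle V W).

Definition gr_dist_set (R : realType) (d : gr_metric) (k n : nat)
    (V : Gr R k n) (S : set (Gr R k n)) : \bar R :=
  ereal_inf [set gr_dist d V W | W in S].

Definition Omega_plus (R : realType) (k l n : nat) (A : Gr R k n) :
    set (Gr R l n) :=
  [set X : Gr R l n | (A <= X)%VS].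

Definition Omega_minus (R : realType) (k l n : nat) (B : Gr R l n) :
    set (Gr R k n) :=
  [set Y : Gr R k n | (Y <= B)%VS].

Section BasisIndependence.
Variable R : realType.

Lemma tr_mul_self_eq0 n (v : 'cV[R]_n) : v^T *m v = 0 -> v = 0.
Proof.
move=> /matrixP /(_ 0 0); rewrite !mxE => /eqP.
rewrite psumr_eq0 => [/allP h|i _]; last by rewrite mxE -expr2 sqr_ge0.
apply/matrixP => i j; rewrite !ord1 mxE.
have /= := h i (mem_index_enum i).
by rewrite mxE -expr2 sqrf_eq0 => /eqP.
Qed.

Lemma mulmx_mem_cols n k (A : 'M[R]_(n, k)) (c : 'cV[R]_k) :
  A *m c \in <<[seq col j A | j : 'I_k]>>%VS.
Proof.
have -> : A *m c = \sum_j c j 0 *: col j A.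
  apply/matrixP => i j; rewrite !mxE summxE ord1.
  by apply: eq_bigr => l _; rewrite !mxE mulrC.
apply: memv_suml => j _; apply: memvZ; apply: memv_span.
by apply/mapP; exists j; rewrite ?mem_enum.
Qed.

Lemma cols_memP n k (A : 'M[R]_(n, k)) (v : 'cV[R]_n) :
  v \in <<[seq col j A | j : 'I_k]>>%VS -> exists c : 'cV[R]_k, v = A *m c.
Proof.
rewrite span_def big_map big_enum /= => /memv_sumP[vs hvs ->].
have /choice[f hf] : forall j, exists c, vs j = c *: col j A.
  by move=> j; apply/vlineP; apply: hvs.
exists (\col_j f j); apply/matrixP => i j; rewrite !mxE summxE ord1.
by apply: eq_bigr => l _; rewrite hf !mxE mulrC.
Qed.

Lemma orthonormal_cols n (V : {vspace 'cV[R]_n}) j : (j <= \dim V)%N ->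
  exists A : 'M[R]_(n, j),
    A^T *m A = 1%:M /\ (<<[seq col i A | i : 'I_j]>> <= V)%VS.
Proof.
elim: j => [_|j IH jV].
  exists 0; split; first by apply/matrixP => -[].
  by apply/span_subvP => v /mapP[[]].
have [A [AA AV]] := IH (ltnW jV).
have /subvPn[v vV vA] : ~~ (V <= <<[seq col i A | i : 'I_j]>>)%VS.
  apply/negP => /dimvS; apply/negP; rewrite -ltnNge (leq_ltn_trans _ jV) //.
  by rewrite (leq_trans (dim_span _)) // size_map size_enum_ord.
pose w := v - A *m (A^T *m v).
have wV : w \in V by rewrite memvB // (subvP AV) // mulmx_mem_cols.
have Aw : A^T *m w = 0 by rewrite mulmxBr !mulmxA AA mul1mx subrr.
have w0 : w != 0.
  apply: contraNneq vA => /eqP; rewrite subr_eq0 => /eqP ->.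
  exact: mulmx_mem_cols.
pose s := (w^T *m w) 0 0.
have ws : w^T *m w = s%:M.
  by apply/matrixP => a b; rewrite !ord1 [RHS]mxE eqxx mulr1n.
have s0 : 0 < s.
  rewrite lt_neqAle; apply/andP; split.
    rewrite eq_sym; apply: contra_neq w0 => s0; apply: tr_mul_self_eq0.
    by rewrite ws s0 raddf0.
  by rewrite /s mxE sumr_ge0 // => i _; rewrite mxE -expr2 sqr_ge0.
pose u := (Num.sqrt s)^-1 *: w.
have uu : u^T *m u = 1%:M.
  have -> : u^T = (Num.sqrt s)^-1 *: w^T by rewrite /u linearZ.
  rewrite -scalemxAl -scalemxAr scalerA ws.
  rewrite scale_scalar_mx -invfM -expr2 sqr_sqrtr ?ltW //.
  by rewrite mulVf // gt_eqF.
have Au : A^T *m u = 0 by rewrite /u -scalemxAr Aw scaler0.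
have uA : u^T *m A = 0 by rewrite -[LHS]trmxK trmx_mul trmxK Au trmx0.
have ON : (row_mx u A)^T *m row_mx u A = 1%:M.
  by rewrite tr_row_mx mul_col_row uu AA Au uA -scalar_mx_block.
exists (row_mx u A); split; first exact: ON.
apply/span_subvP => x /mapP[i _ ->].
case: (split_ordP (i : 'I_(1 + j))) => i' ->.
  rewrite (_ : col _ _ = col i' u); last exact: colKl.
  by rewrite col_id memvZ.
rewrite (_ : col _ _ = col i' A); last exact: colKr.
rewrite (subvP AV) //; apply: memv_span.
by apply/mapP; exists i'; rewrite ?mem_enum.
Qed.

Lemma orthonormal_basis_exists n (V : {vspace 'cV[R]_n}) :
  exists A : 'M[R]_(n, \dim V), orthonormal_basis V A.
Proof.
have [A [AA AV]] := orthonormal_cols (leqnn (\dim V)).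
exists A; split=> //; apply/eqP; rewrite eqEdim AV /=.
have fA : free [seq col i A | i : 'I_(\dim V)].
  apply/(@freeP _ _ _ [tuple col i A | i < \dim V]) => c hc i.
  have A0 : A *m (\col_i c i) = 0.
    rewrite -[RHS]hc; apply/matrixP => a b; rewrite !mxE summxE ord1.
    apply: eq_bigr => l _.
    by rewrite !mxE (nth_map l) ?size_enum_ord // nth_ord_enum mxE mulrC.
  have := congr1 (mulmx A^T) A0; rewrite mulmxA AA mul1mx mulmx0.
  by move=> /matrixP /(_ i 0); rewrite !mxE.
by move: fA; rewrite /free => /eqP ->; rewrite size_map size_enum_ord.
Qed.

Lemma orthonormal_basis_of_gr k n (V : Gr R k n) :
  orthonormal_basis V (gr_basis V).
Proof.
apply: (@xgetPex _ 0 [set A | orthonormal_basis V A]) => /=.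
by case: V => V /= <-; exact: orthonormal_basis_exists.
Qed.

Lemma char_poly_conj k (P Q S : 'M[R]_k) : P *m Q = 1%:M ->
  char_poly (P *m S *m Q) = char_poly S.
Proof.
move=> PQ; rewrite /char_poly /char_poly_mx.
set p := map_mx (@polyC R) P; set q := map_mx (@polyC R) Q.
have pq : p *m q = 1%:M by rewrite -map_mxM PQ map_mx1.
have -> : 'X%:M - map_mx (@polyC R) (P *m S *m Q) =
    p *m ('X%:M - map_mx polyC S) *m q.
  rewrite mulmxBr mulmxBl (scalar_mxC 'X p) -['X%:M *m p *m q]mulmxA pq mulmx1.
  by rewrite !map_mxM.
by rewrite !det_mulmx mulrAC -det_mulmx pq det1 mul1r.
Qed.

Lemma orthonormal_basis_change k n (V : {vspace 'cV[R]_n})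
    (A A' : 'M[R]_(n, k)) :
  orthonormal_basis V A -> orthonormal_basis V A' ->
  exists Q : 'M[R]_k, A' = A *m Q /\ Q^T *m Q = 1%:M.
Proof.
move=> [AA AV] [AA' AV'].
have A'E : A' = A *m (A^T *m A').
  suff cE j : col j A' = A *m (A^T *m col j A').
    apply/matrixP => i j; have /matrixP /(_ i 0) := cE j.
    by rewrite colE !mulmxA -!colE !mxE.
  have : col j A' \in <<[seq col j A | j : 'I_k]>>%VS.
    by rewrite AV -AV'; apply/memv_span/mapP; exists j; rewrite ?mem_enum.
  by case/cols_memP => c ->; rewrite [A^T *m _]mulmxA AA mul1mx.
exists (A^T *m A'); split=> //.
by rewrite trmx_mul trmxK -mulmxA -A'E AA'.
Qed.

Lemma principal_angleE k l n (V : Gr R k n) (W : Gr R l n)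
    (A : 'M[R]_(n, k)) (B : 'M[R]_(n, l)) i :
  orthonormal_basis V A -> orthonormal_basis W B ->
  principal_angle V W i = acos (singular_values (A^T *m B))`_i.
Proof.
move=> hA hB; rewrite /principal_angle; congr (acos _`_i).
have [Q [-> QQ]] := orthonormal_basis_change hA (orthonormal_basis_of_gr V).
have [P [-> PP]] := orthonormal_basis_change hB (orthonormal_basis_of_gr W).
rewrite /singular_values /real_eigenvalues.
have -> : ((A *m Q)^T *m (B *m P))^T *m ((A *m Q)^T *m (B *m P)) =
    P^T *m ((A^T *m B)^T *m (A^T *m B)) *m P.
  have QQ' : Q *m Q^T = 1%:M by apply: mulmx1C.
  rewrite !trmx_mul !trmxK !mulmxA -[_ *m Q *m Q^T]mulmxA QQ'.
  by rewrite mulmx1 ?mulmxA.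
by rewrite char_poly_conj.
Qed.

End BasisIndependence.

(* Main.v *)
(** Let l = k + r, let A, B be matrices whose columns are orthonormal bases of
the two subspaces and M = A^T B.  The min-max characterization of the
eigenvalues of Gram matrices compares singular values under linear constraints.
If Y = B Q lies in the span of B, then x |-> Q x shows that the singular values
of A^T Y are at most those of M.  If X contains the span of A, then the vectors
x for which X^T B x lies in the image of A are cut out by r equations and
satisfy |X^T B x| = |M x|, so that sigma_(i+r) (X^T B) <= sigma_i (M).  Hence
the angles of (A, Y), and the k largest angles of (B, X), dominate those of
(A, B), and every one of the eight distances is monotone in the angles and
insensitive to zero angles.

The bounds are attained simultaneously in a basis B = [B1, B2] of right singular
vectors of M, where B2 spans r vectors in the kernel of M: take Y = B1 and
X = [A, B2], for which X^T B is block diagonal with blocks A^T B1 and 1. *)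

Require Import Defs.
From mathcomp Require Import all_boot all_order all_algebra.
From mathcomp Require Import all_classical all_reals all_analysis.
From mathcomp Require Import perm polyrcf spectral complex.
From mathcomp Require Import zify ring lra.

Set Implicit Arguments.
Unset Strict Implicit.
Unset Printing Implicit Defensive.

Import Order.TTheory GRing.Theory Num.Theory.

Local Open Scope ring_scope.

(** * The real spectral theorem *)

(** By rank-nullity, [p] equations in [p + r] unknowns leave a kernel of dimension at least [r]. The
    case [r = 1] supplies the unit test vectors of the min-max arguments. *)
Lemma kernel_isometry (R : realType) p r (C : 'M[R]_(p, p + r)) :
  exists Q : 'M[R]_(p + r, r), Q^T *m Q = 1%:M /\ C *m Q = 0.
Proof.
pose f := linfun (mulmx C : 'cV[R]_(p + r) -> 'cV[R]_p).
have rker : (r <= \dim (lker f))%N.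
  have := limg_ker_dim f fullv; rewrite capfv dimvf /dim /= muln1.
  have := dimvS (subvf (limg f)); rewrite dimvf /dim /= muln1.
  by move: (\dim (lker f)) (\dim (limg f)) => a b; lia.
have [Q [QQ Qker]] := orthonormal_cols rker.
exists Q; split=> //; apply/matrixP => i j.
have : col j Q \in lker f.
  by apply/(subvP Qker)/memv_span/mapP; exists j; rewrite ?mem_enum.
rewrite memv_ker lfunE /= => /eqP /matrixP /(_ i 0).
by rewrite colE mulmxA -colE !mxE.
Qed.

Lemma orthonormal_completion (R : realType) p r (Q : 'M[R]_(p + r, p)) :
  Q^T *m Q = 1%:M ->
  exists Q' : 'M[R]_(p + r, r),
    (row_mx Q Q')^T *m row_mx Q Q' = 1%:M.
Proof.
move=> QQ; have [Q' [Q'Q' QQ']] := kernel_isometry Q^T; exists Q'.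
have Q'Q : Q'^T *m Q = 0 by rewrite -[LHS]trmxK trmx_mul trmxK QQ' trmx0.
by rewrite tr_row_mx mul_col_row QQ Q'Q' QQ' Q'Q -scalar_mx_block.
Qed.

Lemma orthonormal_row_mx (R : realType) n p q
    (P : 'M[R]_(n, p)) (Q : 'M[R]_(n, q)) :
  (row_mx P Q)^T *m row_mx P Q = 1%:M ->
  [/\ P^T *m P = 1%:M, P^T *m Q = 0, Q^T *m P = 0 & Q^T *m Q = 1%:M].
Proof.
move=> ON; move: (etrans ON (scalar_mx_block _ _ _)).
by rewrite tr_row_mx mul_col_row => /eq_block_mx[].
Qed.

Lemma quad_ge0 (R : realType) n (v : 'cV[R]_n) : 0 <= (v^T *m v) 0 0.
Proof. by rewrite mxE sumr_ge0 // => i _; rewrite mxE -expr2 sqr_ge0. Qed.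

Lemma quad_gt0 (R : realType) n (v : 'cV[R]_n) : v != 0 -> 0 < (v^T *m v) 0 0.
Proof.
move=> v0; rewrite lt_neqAle quad_ge0 andbT eq_sym.
apply: contra_neq v0 => q0; apply: tr_mul_self_eq0.
by rewrite [_ *m _]mx11_scalar q0 raddf0.
Qed.

Lemma symmetric_eigenvector (R : realType) n (S : 'M[R]_(1 + n)) :
  S^T = S ->
  exists (u : 'cV[R]_(1 + n)) (a : R), u^T *m u = 1%:M /\ S *m u = a *: u.
Proof.
move=> Ssym; pose f : {rmorphism R -> complex R} := real_complex R.
(* [S] is Hermitian over [R[i]], so its complex eigenvalues are real *)
pose T : 'M[complex R]_(1 + n) := map_mx f S.
have Therm : T \is hermsymmx.
  apply/is_hermitianmxP; rewrite scale1r /T -{1}Ssym.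
  by apply/matrixP => i j; rewrite !mxE; apply/esym/conjc_real.
have [a Sa] : exists a, root (char_poly S) a.
  have /orthomx_spectralP TE := hermitian_normalmx Therm.
  have /mxOverP /(_ 0 0) /complex_realP[a da] :=
    hermitian_spectral_diag_real Therm.
  have Pu := spectral_unit T.
  exists a; rewrite -(fmorph_root f) map_char_poly -/T -eigenvalue_root_char.
  apply/eigenvalueP; exists (row 0 (spectralmx T)).
    rewrite -row_mul [X in row 0 (_ *m X)]TE !mulmxA mulmxV // mul1mx.
    by rewrite row_mul row_diag_mx -scalemxAl -rowE da.
  apply/eqP => /(congr1 (mulmx^~ (invmx (spectralmx T)))).
  rewrite rowE mulmxK // mul0mx => /matrixP /(_ 0 0) /eqP.
  by rewrite !mxE !eqxx oner_eq0.
(* Since [a] is a root of the real polynomial [char_poly S], it has a real eigenvector. This is a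
   row vector [v], which symmetry of [S] turns into the column [v^T]. *)
have /eigenvalueP[v vS v0] : eigenvalue S a by rewrite eigenvalue_root_char.
pose s := ((v^T)^T *m v^T) 0 0.
have s0 : 0 < s by rewrite quad_gt0 // trmx_eq0.
exists ((Num.sqrt s)^-1 *: v^T), a; split.
  have -> : ((Num.sqrt s)^-1 *: v^T)^T = (Num.sqrt s)^-1 *: (v^T)^T.
    by rewrite linearZ.
  rewrite -scalemxAl -scalemxAr scalerA [_ *m _]mx11_scalar -/s.
  rewrite scale_scalar_mx -invfM -expr2 sqr_sqrtr ?ltW //.
  by rewrite mulVf // gt_eqF.
by rewrite -scalemxAr -[S]Ssym -trmx_mul vS linearZ /= !scalerA mulrC.
Qed.

(** Deflation: a unit eigenvector [u] is completed by [Q] to an orthonormal basis. Symmetry gives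
    [u^T *m S = a *: u^T], so the off-diagonal blocks vanish and induction applies to the symmetric
    matrix [Q^T *m S *m Q]. *)
Lemma spectral_diagonalization (R : realType) n (S : 'M[R]_n) : S^T = S ->
  exists (P : 'M[R]_n) (d : 'rV[R]_n),
    P^T *m P = 1%:M /\ P^T *m S *m P = diag_mx d.
Proof.
elim: n S => [|n IH]; first by exists 1%:M, 0; split; apply/matrixP => -[].
rewrite -[n.+1]/(1 + n)%N => S Ssym.
have [u [a [uu Su]]] := symmetric_eigenvector Ssym.
have [Q UU] := orthonormal_completion uu.
have [_ uQ Qu QQ] := orthonormal_row_mx UU.
have uS : u^T *m S = a *: u^T by rewrite -[S]Ssym -trmx_mul Su linearZ.
have [|P [d [PP PSP]]] := IH (Q^T *m S *m Q).
  by rewrite !trmx_mul trmxK Ssym mulmxA.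
have QPS : (Q *m P)^T = P^T *m Q^T by rewrite trmx_mul.
exists (row_mx u (Q *m P)), (row_mx a%:M d); split.
  rewrite tr_row_mx mul_col_row uu QPS mulmxA uQ mul0mx.
  rewrite -[P^T *m Q^T *m u]mulmxA Qu mulmx0.
  rewrite mulmxA -[P^T *m Q^T *m Q]mulmxA QQ mulmx1 PP.
  by rewrite -scalar_mx_block.
rewrite tr_row_mx mul_col_mx mul_col_row QPS uS -[_ *m S *m u]mulmxA Su.
rewrite -!scalemxAl -scalemxAr uu [u^T *m _]mulmxA uQ mul0mx scaler0.
rewrite -[P^T *m Q^T *m u]mulmxA Qu mulmx0 scaler0 scalemx1.
have -> : P^T *m Q^T *m S *m (Q *m P) = diag_mx d by rewrite -PSP !mulmxA.
rewrite diag_mx_row; congr block_mx.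
by apply/matrixP => i j; rewrite !mxE !ord1.
Qed.

(** A factorization into linear factors determines the roots with their multiplicities up to order,
    and sorting removes the order. *)
Lemma real_eigenvalues_char_poly (R : realType) n (S : 'M[R]_n) (r : seq R) :
  char_poly S = \prod_(x <- r) ('X - x%:P) ->
  real_eigenvalues S = sort >=%R r.
Proof.
move=> charS; rewrite /real_eigenvalues; apply/perm_sortP.
- by move=> x y; rewrite /= le_total.
- by move=> x y z /= xy zx; apply: le_trans xy.
- by move=> x y /=; rewrite andbC => /le_anti.
rewrite -(permPr (perm_count_undup r)) charS.
apply: perm_trans (perm_flatten (perm_map _ _)).
  by under eq_map do rewrite mu_prod_XsubC.
apply: uniq_perm; rewrite ?undup_uniq ?uniq_roots // => x.
rewrite mem_undup -roots_on_rootsR ?monic_neq0 ?monic_prod_XsubC //.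
by rewrite in_itv /= root_prod_XsubC.
Qed.

Lemma sorted_spectral_decomposition (R : realType) n (S : 'M[R]_n) : S^T = S ->
  [/\ size (real_eigenvalues S) = n, sorted >=%R (real_eigenvalues S) &
   exists P : 'M[R]_n, P^T *m P = 1%:M /\
     P^T *m S *m P = diag_mx (\row_i (real_eigenvalues S)`_i)].
Proof.
move=> Ssym; have [P [d [PP PSP]]] := spectral_diagonalization Ssym.
have eigS : real_eigenvalues S = sort >=%R [tuple d 0 i | i < n].
  apply: real_eigenvalues_char_poly; rewrite -(char_poly_conj S PP) PSP.
  rewrite char_poly_trig ?diag_mx_is_trig // big_map big_enum /=.
  by apply: eq_bigr => i _; rewrite mxE eqxx.
have sizeS : size (real_eigenvalues S) = n by rewrite eigS size_sort size_tuple.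
split=> //; first by rewrite eigS sort_sorted // => x y; exact: le_total.
have /tuple_permP[p pE] : perm_eq (real_eigenvalues S) [tuple d 0 i | i < n].
  by rewrite eigS perm_sort.
(* The eigenvectors are permuted in the same way as the eigenvalues were by sorting. *)
exists (col_perm p P); split.
  apply/matrixP => i j; have /matrixP /(_ (p i) (p j)) := PP.
  rewrite !mxE (inj_eq perm_inj) => <-.
  by apply: eq_bigr => l _; rewrite !mxE.
apply/matrixP => i j; have /matrixP /(_ (p i) (p j)) := PSP.
rewrite !mxE (inj_eq perm_inj) pE.
rewrite (nth_map i) ?size_enum_ord // nth_ord_enum tnth_mktuple => <-.
apply: eq_bigr => l _; rewrite !mxE; congr (_ * _).
by apply: eq_bigr => m _; rewrite !mxE.
Qed.

(** * Min-max and interlacing *)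

Lemma quad_diag (R : realType) n (d : 'rV[R]_n) (y : 'cV[R]_n) :
  (y^T *m diag_mx d *m y) 0 0 = \sum_j d 0 j * y j 0 ^+ 2.
Proof.
rewrite mxE; apply: eq_bigr => j _.
by rewrite mul_mx_diag !mxE expr2; ring.
Qed.

Lemma quad_sum (R : realType) n (y : 'cV[R]_n) :
  (y^T *m y) 0 0 = \sum_j y j 0 ^+ 2.
Proof. by rewrite mxE; apply: eq_bigr => j _; rewrite mxE expr2. Qed.

Lemma isometry_quad (R : realType) m n (Q : 'M[R]_(m, n)) (x : 'cV[R]_n) :
  Q^T *m Q = 1%:M -> (Q *m x)^T *m (Q *m x) = x^T *m x.
Proof. by move=> QQ; rewrite trmx_mul !mulmxA -(mulmxA x^T) QQ mulmx1. Qed.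

Lemma sorted_ge_nth (R : realType) (s : seq R) i j :
  sorted >=%R s -> (i <= j < size s)%N -> s`_j <= s`_i.
Proof.
move=> s_sorted /andP[ij js].
have ge_trans : transitive (>=%R : rel R).
  by move=> x y z /= yx xz; apply: le_trans yx.
have ge_refl : reflexive (>=%R : rel R) by move=> x /=; apply: lexx.
apply: (sorted_leq_nth ge_trans ge_refl 0 s_sorted) => //.
exact: leq_ltn_trans ij js.
Qed.

(** One half of Courant-Fischer: [V] consists of eigenvectors for the [i + 1] largest eigenvalues,
    each of which is at least the one of index [i]. *)
Lemma real_eigenvalues_maxmin (R : realType) n (S : 'M[R]_n) i :
  S^T = S -> (i < n)%N ->
  exists2 V : 'M[R]_(n, i + 1), V^T *m V = 1%:M & forall x : 'cV_(i + 1),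
    (real_eigenvalues S)`_i * (x^T *m x) 0 0 <=
      ((V *m x)^T *m S *m (V *m x)) 0 0.
Proof.
move=> /sorted_spectral_decomposition[sizeS sortedS [P [PP PSP]]] ltin.
have le1 : (i + 1 <= n)%N by rewrite addn1.
pose E : 'M[R]_(n, i + 1) := colsub (widen_ord le1) 1%:M.
have EE : E^T *m E = 1%:M.
  apply/matrixP => a b; rewrite !mxE.
  rewrite (bigD1 (widen_ord le1 a)) //= big1 => [|j ja].
    by rewrite !mxE eqxx mul1r addr0.
  by rewrite !mxE (negPf ja) mul0r.
exists (P *m E); first by rewrite trmx_mul !mulmxA -(mulmxA E^T) PP mulmx1.
move=> x; rewrite -(isometry_quad x EE) -(mulmxA P E x); set y := E *m x.
have -> : (P *m y)^T *m S *m (P *m y) = y^T *m (P^T *m S *m P) *m y.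
  by rewrite trmx_mul !mulmxA.
rewrite PSP quad_diag quad_sum mulr_sumr; apply: ler_sum => j _.
rewrite [(\row__ _) _ _]mxE.
have [ji|ij] := leqP j i.
  by apply: ler_wpM2r; rewrite ?sqr_ge0 // sorted_ge_nth // ji sizeS.
suff -> : y j 0 = 0 by rewrite expr0n !mulr0.
rewrite mxE big1 // => b _; rewrite !mxE; case: eqP => [jb|]; rewrite ?mul0r //.
by have := ltn_ord b; rewrite jb /= in ij; lia.
Qed.

(** The dual half: [D] reads off the coordinates along the first [i] eigenvectors, so its kernel
    meets only eigenvalues of index at least [i]. *)
Lemma real_eigenvalues_minmax (R : realType) n (S : 'M[R]_n) i :
  S^T = S -> (i < n)%N ->
  exists D : 'M[R]_(i, n), forall x : 'cV_n, D *m x = 0 ->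
    (x^T *m S *m x) 0 0 <= (real_eigenvalues S)`_i * (x^T *m x) 0 0.
Proof.
move=> /sorted_spectral_decomposition[sizeS sortedS [P [PP PSP]]] ltin.
exists (rowsub (widen_ord (ltnW ltin)) P^T) => x Dx0.
pose y := P^T *m x; have xE : x = P *m y by rewrite mulmxA mulmx1C // mul1mx.
rewrite xE isometry_quad //.
have -> : (P *m y)^T *m S *m (P *m y) = y^T *m (P^T *m S *m P) *m y.
  by rewrite trmx_mul !mulmxA.
rewrite PSP quad_diag quad_sum mulr_sumr; apply: ler_sum => j _.
rewrite [(\row__ _) _ _]mxE.
have [ij|ji] := leqP i j.
  by apply: ler_wpM2r; rewrite ?sqr_ge0 // sorted_ge_nth // ij sizeS ltn_ord.
suff -> : y j 0 = 0 by rewrite expr0n !mulr0.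
have /matrixP /(_ (Ordinal ji) 0) := Dx0; rewrite mxE [RHS]mxE => <-.
rewrite mxE; apply: eq_bigr => l _; rewrite !mxE; congr (P l _ * _).
exact: val_inj.
Qed.

(** Dimension count: [V] has [i + r + 1] columns, while [D *m J] and [C] impose [i + r] equations on
    its range. A unit vector solving them all has its Rayleigh quotients between the two
    eigenvalues. *)
Lemma real_eigenvalues_interlacing (R : realType) l l' r
    (S : 'M[R]_l) (S' : 'M[R]_l') (J : 'M[R]_(l, l')) (C : 'M[R]_(r, l')) i :
  S^T = S -> S'^T = S' -> (i < l)%N -> (i + r < l')%N ->
  (forall c : 'cV_l', C *m c = 0 -> (J *m c)^T *m (J *m c) = c^T *m c) ->
  (forall c : 'cV_l', C *m c = 0 ->
    (c^T *m S' *m c) 0 0 <= ((J *m c)^T *m S *m (J *m c)) 0 0) ->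
  (real_eigenvalues S')`_(i + r) <= (real_eigenvalues S)`_i.
Proof.
move=> Ssym S'sym il irl' isoJ leJ.
have [D DS] := real_eigenvalues_minmax Ssym il.
have [V VV VS'] := real_eigenvalues_maxmin S'sym irl'.
have [x [xx]] := kernel_isometry (col_mx (D *m J *m V) (C *m V)).
rewrite mul_col_mx -[0]vsubmxK linear0 linear0 => /eq_col_mx[DJx Cx].
have x1 : (x^T *m x) 0 0 = 1 by rewrite xx mxE eqxx.
rewrite -mulmxA in Cx; rewrite -!mulmxA in DJx.
have := VS' x; rewrite x1 mulr1 => /le_trans; apply.
apply: (le_trans (leJ _ Cx)); apply: (le_trans (DS _ DJx)).
by rewrite isoJ // isometry_quad // x1 mulr1.
Qed.

(** * Gram matrices and singular values *)

Lemma mulmx_tr_sym (R : realType) m n (M : 'M[R]_(m, n)) :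
  (M^T *m M)^T = M^T *m M.
Proof. by rewrite trmx_mul trmxK. Qed.

Lemma gram_quad (R : realType) m n (M : 'M[R]_(m, n)) (x : 'cV[R]_n) :
  x^T *m (M^T *m M) *m x = (M *m x)^T *m (M *m x).
Proof. by rewrite trmx_mul !mulmxA. Qed.

Lemma real_eigenvalues_gram_ge0 (R : realType) m n (M : 'M[R]_(m, n)) i :
  0 <= (real_eigenvalues (M^T *m M))`_i.
Proof.
have [sizeS _ _] := sorted_spectral_decomposition (mulmx_tr_sym M).
(* Beyond the size of the list the entry is the default [0]. *)
have [lein|ltin] := leqP n i; first by rewrite nth_default // sizeS.
have [D DS] := real_eigenvalues_minmax (mulmx_tr_sym M) ltin.
have [V VV VS] := real_eigenvalues_maxmin (mulmx_tr_sym M) ltin.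
have [x [xx Dx]] := kernel_isometry (D *m V).
have x1 : (x^T *m x) 0 0 = 1 by rewrite xx mxE eqxx.
rewrite -mulmxA in Dx.
have := DS _ Dx; rewrite isometry_quad // x1 mulr1; apply: le_trans.
by rewrite gram_quad quad_ge0.
Qed.

(** A unit vector [u] in the range of [V] with [D *m (M *m u) = 0] satisfies [s <= a] for [a] the
    squared norm of [M *m u], and [b <= s' * a] for [b] that of [M^T *m (M *m u)]. *)
Lemma real_eigenvalues_gram_tr_le (R : realType) m n (M : 'M[R]_(m, n)) i :
  (i < minn m n)%N ->
  (real_eigenvalues (M^T *m M))`_i <= (real_eigenvalues (M *m M^T))`_i.
Proof.
rewrite leq_min => /andP[im i_n].
have Msym : (M *m M^T)^T = M *m M^T by rewrite trmx_mul trmxK.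
have [D DS] := real_eigenvalues_minmax Msym im.
have [V VV VS] := real_eigenvalues_maxmin (mulmx_tr_sym M) i_n.
have s'ge0 : 0 <= (real_eigenvalues (M *m M^T))`_i.
  by rewrite -{1}[M]trmxK real_eigenvalues_gram_ge0.
set s := _`_i in VS *; set s' := _`_i in DS s'ge0 *.
have [x [xx Dx]] := kernel_isometry (D *m M *m V).
have x1 : (x^T *m x) 0 0 = 1 by rewrite xx mxE eqxx.
rewrite -!mulmxA in Dx; have DSx := DS _ Dx.
move: (VS x); rewrite x1 mulr1 => VSx.
set u := V *m x in Dx DSx VSx.
have uu : (u^T *m u) 0 0 = 1 by rewrite isometry_quad.
set a : R := ((M *m u)^T *m (M *m u)) 0 0 in DSx.
set b : R := ((M *m u)^T *m _ *m _) 0 0 in DSx.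
have uMMu : u^T *m (M^T *m (M *m u)) = a%:M.
  by rewrite mulmxA -trmx_mul [LHS]mx11_scalar.
have sa : s <= a by move: VSx; rewrite -!mulmxA uMMu mxE eqxx.
have a_ge0 : 0 <= a by exact: quad_ge0.
(* Cauchy-Schwarz for [u] and [M^T M u], as [|M^T M u - a u|^2 >= 0] *)
have : a ^+ 2 <= b.
  have := quad_ge0 (M^T *m (M *m u) - a *: u).
  have -> : (M^T *m (M *m u) - a *: u)^T = (M^T *m (M *m u))^T - a *: u^T.
    by rewrite linearB /= linearZ.
  rewrite mulmxBr !mulmxBl -!scalemxAl -!scalemxAr uMMu.
  have -> : (M^T *m (M *m u))^T *m u = a%:M.
    by rewrite -[LHS]trmxK trmx_mul trmxK uMMu tr_scalar_mx.
  have -> : (M^T *m (M *m u))^T *m (M^T *m (M *m u)) = b%:M.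
    by rewrite [LHS]mx11_scalar trmx_mul trmxK /b !mulmxA.
  by rewrite [u^T *m u]mx11_scalar uu !mxE !eqxx !mulr1n; nra.
(* Now [a ^+ 2 <= s' * a]: either [a <= s'], or [a = 0] and then [s <= 0 <= s']. *)
nra.
Qed.

(** Singular values are defined through [M^T *m M] alone; this makes the principal angles symmetric
    in the two subspaces. *)
Lemma singular_values_tr (R : realType) m n (M : 'M[R]_(m, n)) i :
  (i < minn m n)%N -> (singular_values M^T)`_i = (singular_values M)`_i.
Proof.
move=> imn; rewrite /singular_values minnC !nth_take // trmxK.
have [sizeM _ _] := sorted_spectral_decomposition (mulmx_tr_sym M).
have [] := sorted_spectral_decomposition (mulmx_tr_sym M^T).
rewrite trmxK => sizeMt _ _.
move: (imn); rewrite leq_min => /andP[im i_n].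
rewrite !(nth_map 0) ?sizeM ?sizeMt //; congr (Num.sqrt _); apply/le_anti.
rewrite (real_eigenvalues_gram_tr_le _ imn) andbT.
by have := @real_eigenvalues_gram_tr_le R n m M^T i; rewrite trmxK minnC; apply.
Qed.

Lemma singular_valuesE (R : realType) m n (M : 'M[R]_(m, n)) i :
  (i < minn m n)%N ->
  (singular_values M)`_i = Num.sqrt (real_eigenvalues (M^T *m M))`_i.
Proof.
move=> imn; rewrite /singular_values nth_take //.
have [sizeM _ _] := sorted_spectral_decomposition (mulmx_tr_sym M).
rewrite (nth_map 0) // sizeM.
by move: imn; rewrite leq_min => /andP[].
Qed.

(** * Monotonicity of the distances in the angles *)

Lemma big_ord_addn (T : Type) (idx : T) (op : Monoid.law idx) k r
    (F : nat -> T) :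
  \big[op/idx]_(i < k + r) F i =
  op (\big[op/idx]_(i < r) F i) (\big[op/idx]_(i < k) F (i + r)%N).
Proof.
rewrite -!(big_mkord xpredT F) -(big_mkord xpredT (fun i => F (i + r)%N)).
rewrite (big_cat_nat (leq0n r) (leq_addl k r)) /=.
by rewrite -[X in \big[_/_]_(X <= _ < k + r) _]add0n big_addn addnK.
Qed.

Section OfAngles.
Variable R : realType.
Implicit Types x y : R.

Lemma ler_cos x y : 0 <= x -> x <= y -> y <= pi -> cos y <= cos x.
Proof.
move=> x0 xy ypi; rewrite leNgt ltr_cos ?in_itv /= -?leNgt //; lra.
Qed.

Lemma ler_sin x y : 0 <= x -> x <= y -> y <= pi / 2 -> sin x <= sin y.
Proof.
move=> x0 xy ypi; rewrite leNgt ltr_sin ?in_itv /= -?leNgt //; lra.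
Qed.

Lemma ler_acos x y : 0 <= x -> x <= y -> y <= 1 -> acos y <= acos x.
Proof.
move=> x0 xy y1.
have xI : -1 <= x <= 1 by lra.
have yI : -1 <= y <= 1 by lra.
rewrite leNgt -ltr_cos ?in_itv /= ?acos_ge0 ?acos_lepi //.
by rewrite !acosK ?in_itv //= -leNgt.
Qed.

(** The first [r] angles of [theta'] contribute cosines in [0, 1] or nonnegative summands, so
    dropping them can only decrease the distance; the remaining ones are compared term by term. *)
Lemma of_angles_le (d : gr_metric) k r (theta theta' : nat -> R) :
  (0 < k)%N ->
  (forall i, (i < k)%N -> 0 <= theta i <= theta' (i + r)%N) ->
  (forall i, (i < k + r)%N -> 0 <= theta' i <= pi / 2) ->
  (of_angles d k theta <= of_angles d (k + r) theta')%E.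
Proof.
move=> k0 le_theta theta'I.
have pi0 := pi_gt0 R.
have ltk (i : 'I_k) : (i + r < k + r)%N by rewrite ltn_add2r.
have ltr_kr (i : 'I_r) : (i < k + r)%N by rewrite ltn_addl.
have lastI : 0 <= theta k.-1 /\ theta k.-1 <= theta' (k + r).-1 /\
    theta' (k + r).-1 <= pi / 2.
  have -> : (k + r).-1 = (k.-1 + r)%N by lia.
  have lk : (k.-1 < k)%N by lia.
  have /andP[t0 tt'] := le_theta _ lk.
  have /andP[_ t'p] : 0 <= theta' (k.-1 + r)%N <= pi / 2 by apply: theta'I; lia.
  by [].
have cosI (i : 'I_(k + r)) : 0 <= cos (theta' i) <= 1.
  have := theta'I i (ltn_ord i) => h; rewrite cos_le1 cos_ge0_pihalf //; lra.
have le_cos (i : 'I_k) : 0 <= cos (theta' (i + r)%N) <= cos (theta i).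
  have /andP[t0 tt'] := le_theta i (ltn_ord i).
  have /andP[t'0 t'p] := theta'I _ (ltk i).
  rewrite cos_ge0_pihalf ?ler_cos //; lra.
have le_prod_cos :
    \prod_(i < k + r) cos (theta' i) <= \prod_(i < k) cos (theta i).
  rewrite (big_ord_addn _ k r (fun i => cos (theta' i))) /=.
  rewrite -[leRHS]mul1r; apply: ler_pM.
  - by apply: prodr_ge0 => i _; have /andP[] := cosI (Ordinal (ltr_kr i)).
  - by apply: prodr_ge0 => i _; have /andP[] := le_cos i.
  - apply: Num.Theory.prodr_ile1 => i _; exact: (cosI (Ordinal (ltr_kr i))).
  - by apply: ler_prod => i _.
have prod_cos_ge0 : 0 <= \prod_(i < k + r) cos (theta' i).
  by apply: prodr_ge0 => i _; have /andP[] := cosI i.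
have le_sum (f : R -> R) :
    (forall x, 0 <= x <= pi / 2 -> 0 <= f x) ->
    (forall x y, 0 <= x -> x <= y -> y <= pi / 2 -> f x <= f y) ->
    \sum_(i < k) f (theta i) <= \sum_(i < k + r) f (theta' i).
  move=> f0 f_le; rewrite (big_ord_addn _ k r (fun i => f (theta' i))) /=.
  rewrite -[leLHS]add0r; apply: lerD.
    by apply: sumr_ge0 => i _; apply/f0/theta'I/ltr_kr.
  apply: ler_sum => i _; have /andP[t0 tt'] := le_theta i (ltn_ord i).
  by have /andP[t'0 t'p] := theta'I _ (ltk i); apply: f_le.
case: d => /=; rewrite ?lee_fin.
- by case: lastI => _ [].
- apply: ler_wsqrtr; rewrite lerD2l lerN2 !prodrXl.
  by rewrite ler_sqr // nnegrE (le_trans prod_cos_ge0).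
- apply/ler_wsqrtr/(le_sum (fun x => sin x ^+ 2)) => [x _|x y x0 xy yp].
    exact: sqr_ge0.
  rewrite ler_sqr ?nnegrE ?ler_sin ?sin_ge0_pi //; lra.
- apply: ler_acos => //; apply: Num.Theory.prodr_ile1 => i _.
  by have /andP[c0 cc] := le_cos i; rewrite cos_le1 (le_trans c0 cc).
- have [/existsP[i theta_pi2]|] :=
    boolP [exists i : 'I_(k + r), theta' i == pi / 2].
    by rewrite leey.
  move=> /existsPn theta'_lt.
  have cos_gt0 (i : 'I_(k + r)) : 0 < cos (theta' i).
    have /andP[t'0 t'p] := theta'I i (ltn_ord i).
    apply: cos_gt0_pihalf.
    rewrite [_ < pi / 2]lt_neqAle theta'_lt t'p andbT; lra.
  (* An angle [theta i] equal to [pi / 2] would force [theta' (i + r)] to be [pi / 2] as well, so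
     both Martin distances are finite here. *)
  case: ifPn => [/existsP[i /eqP thetai]|_].
    have /andP[_ tt'] := le_theta i (ltn_ord i).
    have /andP[_ t'p] := theta'I _ (ltk i).
    have := theta'_lt (Ordinal (ltk i)).
    by rewrite /= eq_le t'p -thetai tt'.
  rewrite lee_fin; apply: ler_wsqrtr.
  have cos_theta_gt0 (i : 'I_k) : 0 < cos (theta i).
    have /andP[_] := le_cos i; apply: lt_le_trans.
    exact: (cos_gt0 (Ordinal (ltk i))).
  rewrite ler_ln ?posrE; last 2 first.
  - by apply: prodr_gt0 => i _; rewrite divr_gt0 // exprn_gt0.
  - by apply: prodr_gt0 => i _; rewrite divr_gt0 // exprn_gt0.
  under eq_bigr do rewrite div1r.
  under [leRHS]eq_bigr do rewrite div1r.
  rewrite !prodfV lef_pV2 ?posrE; last 2 first.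
  - by apply: prodr_gt0 => i _; rewrite exprn_gt0.
  - by apply: prodr_gt0 => i _; rewrite exprn_gt0.
  rewrite !prodrXl ler_sqr // nnegrE ?(le_trans prod_cos_ge0) //.
- rewrite ler_pM2l //.
  apply/ler_wsqrtr/(le_sum (fun x => sin (x / 2) ^+ 2)) => [x _|x y x0 xy yp].
    exact: sqr_ge0.
  rewrite ler_sqr ?nnegrE ?ler_sin ?sin_ge0_pi //; lra.
- by case: lastI => t0 [tt' t'p]; apply: ler_sin.
- by case: lastI => t0 [tt' t'p]; rewrite ler_pM2l // ler_sin //; lra.
Qed.

(** A zero angle contributes the neutral element of each sum or product. With [r = 0] this
    transports the formulas between families that agree only below [k]. *)
Lemma of_angles_eq (d : gr_metric) k r (theta theta' : nat -> R) :
  (0 < k)%N -> (forall i, (i < k)%N -> theta' (i + r)%N = theta i) ->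
  (forall i, (i < r)%N -> theta' i = 0) ->
  of_angles d (k + r) theta' = of_angles d k theta.
Proof.
move=> k0 theta'E theta'0.
have lastE : theta' (k + r).-1 = theta k.-1.
  have -> : (k + r).-1 = (k.-1 + r)%N by lia.
  by apply: theta'E; lia.
have bigE (T : Type) (idx : T) (op : Monoid.law idx) (f : R -> T) : f 0 = idx ->
    \big[op/idx]_(i < k + r) f (theta' i) = \big[op/idx]_(i < k) f (theta i).
  move=> f0; rewrite (big_ord_addn _ k r (fun i => f (theta' i))).
  rewrite big1 => [|i _].
    by rewrite Monoid.mul1m; apply: eq_bigr => i _; rewrite theta'E.
  by rewrite theta'0.
case: d; rewrite /of_angles ?lastE //.
- by rewrite (bigE _ _ _ (fun x => cos x ^+ 2)) // cos0 expr1n.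
- by rewrite (bigE _ _ _ (fun x => sin x ^+ 2)) // sin0 expr0n.
- by rewrite (bigE _ _ _ cos) // cos0.
- rewrite (bigE _ _ _ (fun x => 1 / cos x ^+ 2)) ?cos0 ?expr1n ?divr1 //.
  congr (if _ then _ else _).
  have pi0 := pi_gt0 R.
  apply/existsP/existsP; case=> i.
    have [ir|ri] := ltnP i r; first by rewrite theta'0 // => /eqP; lra.
    have irk : (i - r < k)%N by have := ltn_ord i; lia.
    by exists (Ordinal irk); rewrite /= -theta'E // subnK.
  have irk : (i + r < k + r)%N by rewrite ltn_add2r.
  by exists (Ordinal irk); rewrite /= theta'E.
- by rewrite (bigE _ _ _ (fun x => sin (x / 2) ^+ 2)) // mul0r sin0 expr0n.
Qed.

End OfAngles.

(** * Principal angles and Schubert varieties *)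

Section PrincipalAngles.
Variable R : realType.

Lemma orthonormal_basis_span n k (A : 'M[R]_(n, k)) : A^T *m A = 1%:M ->
  exists V : Gr R k n, orthonormal_basis V A.
Proof.
move=> AA; pose U := <<[seq col j A | j : 'I_k]>>%VS.
suff dimU : \dim U = k by exists (MkGr dimU).
apply/eqP; rewrite eqn_leq; apply/andP; split.
  by apply: leq_trans (dim_span _) _; rewrite size_map size_enum_ord.
have [A' [A'A' A'U]] := orthonormal_basis_exists U.
have /choice[c cE] j : exists c : 'cV_(\dim U), col j A = A' *m c.
  apply: cols_memP; rewrite A'U.
  by apply/memv_span/mapP; exists j; rewrite ?mem_enum.
have AE : A = A' *m (\matrix_(i, j) c j i 0).
  apply/matrixP => i j; have /matrixP /(_ i 0) := cE j; rewrite !mxE => ->.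
  by apply: eq_bigr => l _; rewrite !mxE.
(* The identity of size [k] factors through dimension [\dim U], hence [k <= \dim U]. *)
by move: AA; rewrite {2}AE mulmxA => /mulmx1_min.
Qed.

Lemma span_cols_mulmx n k m (A : 'M[R]_(n, k)) (Q : 'M[R]_(k, m)) :
  (<<[seq col j (A *m Q) | j : 'I_m]>> <= <<[seq col j A | j : 'I_k]>>)%VS.
Proof.
apply/span_subvP => v /mapP[j _ ->].
by rewrite colE -mulmxA mulmx_mem_cols.
Qed.

Lemma orthonormal_basis_rotate n k (V : {vspace 'cV[R]_n})
    (A : 'M[R]_(n, k)) (P : 'M[R]_k) :
  orthonormal_basis V A -> P^T *m P = 1%:M -> orthonormal_basis V (A *m P).
Proof.
move=> [AA AV] PP; split.
  by rewrite trmx_mul mulmxA -(mulmxA P^T) AA mulmx1.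
apply: subv_anti; rewrite -AV span_cols_mulmx /=.
have {1}-> : A = A *m P *m P^T by rewrite -mulmxA mulmx1C // mulmx1.
exact: span_cols_mulmx.
Qed.

(** The orthogonal projection [B *m B^T] onto [W] fixes the columns of [A], so [Q] is [B^T *m A]. *)
Lemma orthonormal_basis_sub n k l (V W : {vspace 'cV[R]_n})
    (A : 'M[R]_(n, k)) (B : 'M[R]_(n, l)) :
  orthonormal_basis V A -> orthonormal_basis W B -> (V <= W)%VS ->
  exists Q : 'M[R]_(l, k), A = B *m Q /\ Q^T *m Q = 1%:M.
Proof.
move=> [AA AV] [BB BW] VW.
have AE : A = B *m (B^T *m A).
  suff cE j : col j A = B *m (B^T *m col j A).
    apply/matrixP => i j; have /matrixP /(_ i 0) := cE j.
    by rewrite colE !mulmxA -!colE !mxE.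
  have : col j A \in <<[seq col j B | j : 'I_l]>>%VS.
    rewrite BW (subvP VW) // -AV.
    by apply/memv_span/mapP; exists j; rewrite ?mem_enum.
  by case/cols_memP => c ->; rewrite [B^T *m _]mulmxA BB mul1mx.
exists (B^T *m A); split=> //.
by rewrite trmx_mul trmxK -mulmxA -AE.
Qed.

(** The difference of the two sides is the squared norm of the residual [y - A *m (A^T *m y)]. *)
Lemma bessel n k (A : 'M[R]_(n, k)) (y : 'cV[R]_n) : A^T *m A = 1%:M ->
  ((A^T *m y)^T *m (A^T *m y)) 0 0 <= (y^T *m y) 0 0.
Proof.
move=> AA; have := quad_ge0 (y - A *m (A^T *m y)).
have -> : (y - A *m (A^T *m y))^T = y^T - y^T *m A *m A^T.
  by rewrite linearB /= !trmx_mul !trmxK.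
rewrite mulmxBr !mulmxBl -[y^T *m A *m A^T *m (A *m _)]mulmxA.
rewrite [A^T *m (A *m _)]mulmxA AA mul1mx !mulmxA subrr subr0.
by rewrite trmx_mul trmxK !mxE subr_ge0.
Qed.

Lemma real_eigenvalues_orthonormal_le1 n k l
    (A : 'M[R]_(n, k)) (B : 'M[R]_(n, l)) i :
  A^T *m A = 1%:M -> B^T *m B = 1%:M ->
  (real_eigenvalues ((A^T *m B)^T *m (A^T *m B)))`_i <= 1.
Proof.
move=> AA BB; have symS := mulmx_tr_sym (A^T *m B).
have [sizeS _ _] := sorted_spectral_decomposition symS.
have [lein|ltin] := leqP l i; first by rewrite nth_default // sizeS.
have [V VV VS] := real_eigenvalues_maxmin symS ltin.
(* The zero matrix imposes no condition: any unit vector will do. *)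
have [x [xx _]] := kernel_isometry (0 : 'M[R]_(i, i + 1)).
have x1 : (x^T *m x) 0 0 = 1 by rewrite xx mxE eqxx.
have := VS x; rewrite x1 mulr1 gram_quad -mulmxA => /le_trans; apply.
apply: le_trans (bessel _ AA) _.
by rewrite !isometry_quad // x1.
Qed.

Lemma principal_angle_eigenvalues k l n (V : Gr R k n) (W : Gr R l n)
    (A : 'M[R]_(n, k)) (B : 'M[R]_(n, l)) i :
  orthonormal_basis V A -> orthonormal_basis W B -> (i < minn k l)%N ->
  principal_angle V W i =
  acos (Num.sqrt (real_eigenvalues ((A^T *m B)^T *m (A^T *m B)))`_i).
Proof.
by move=> VA WB ikl; rewrite (principal_angleE i VA WB) singular_valuesE.
Qed.

Lemma principal_angle_sym k l n (V : Gr R k n) (W : Gr R l n) i :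
  (i < minn k l)%N -> principal_angle V W i = principal_angle W V i.
Proof.
move=> ikl; rewrite /principal_angle -singular_values_tr //.
by rewrite trmx_mul trmxK.
Qed.

Lemma sqrtr_le1 (x : R) : x <= 1 -> Num.sqrt x <= 1.
Proof. by move=> x1; rewrite -[leRHS]sqrtr1 ler_wsqrtr. Qed.

Lemma principal_angle_itv k l n (V : Gr R k n) (W : Gr R l n) i :
  (i < minn k l)%N -> 0 <= principal_angle V W i <= pi / 2.
Proof.
move=> ikl; have hV := orthonormal_basis_of_gr V.
have hW := orthonormal_basis_of_gr W.
rewrite (principal_angle_eigenvalues hV hW) //; set s := _`_i.
have s1 : Num.sqrt s <= 1.
  by apply/sqrtr_le1/real_eigenvalues_orthonormal_le1; [case: hV | case: hW].
have s0 := sqrtr_ge0 s.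
rewrite acos_ge0; last by lra.
by rewrite -acos0 ler_acos.
Qed.

Lemma principal_angle_le k l n (V : Gr R k n) (W : Gr R l n)
    k' l' (V' : Gr R k' n) (W' : Gr R l' n)
    (A : 'M[R]_(n, k)) (B : 'M[R]_(n, l))
    (A' : 'M[R]_(n, k')) (B' : 'M[R]_(n, l'))
    i i' :
  orthonormal_basis V A -> orthonormal_basis W B ->
  orthonormal_basis V' A' -> orthonormal_basis W' B' ->
  (i < minn k l)%N -> (i' < minn k' l')%N ->
  (real_eigenvalues ((A'^T *m B')^T *m (A'^T *m B')))`_i' <=
    (real_eigenvalues ((A^T *m B)^T *m (A^T *m B)))`_i ->
  0 <= principal_angle V W i <= principal_angle V' W' i'.
Proof.
move=> VA WB VA' WB' ikl ikl' le_ev.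
have /andP[-> _] := principal_angle_itv V W ikl.
rewrite (principal_angle_eigenvalues VA WB) //.
rewrite (principal_angle_eigenvalues VA' WB') //.
apply: ler_acos (sqrtr_ge0 _) (ler_wsqrtr le_ev) (sqrtr_le1 _).
by apply: real_eigenvalues_orthonormal_le1; [case: VA | case: WB].
Qed.

Lemma principal_angle_subspace_le k r n (A : Gr R k n) (B : Gr R (k + r) n)
    (Y : Gr R k n) i :
  (Y <= B)%VS -> (i < k)%N ->
  0 <= principal_angle A B i <= principal_angle A Y i.
Proof.
move=> YB ik; have hA := orthonormal_basis_of_gr A.
have hB := orthonormal_basis_of_gr B; have hY := orthonormal_basis_of_gr Y.
apply: (principal_angle_le hA hB hA hY); try lia.
have [Q [-> QQ]] := orthonormal_basis_sub hY hB YB.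
set M := (gr_basis A)^T.
(* No constraint is imposed ([C] has zero rows), and the isometry [J] is [Q], the coordinates of [Y]
   in [B]. *)
have := @real_eigenvalues_interlacing R (k + r) k 0
  ((M *m gr_basis B)^T *m (M *m gr_basis B))
  ((M *m (gr_basis B *m Q))^T *m (M *m (gr_basis B *m Q))) Q 0 i.
rewrite addn0; apply; rewrite ?mulmx_tr_sym //; try lia.
- by move=> c _; rewrite isometry_quad.
- by move=> c _; rewrite !gram_quad !mulmxA.
Qed.

(** Parseval in the basis [row_mx Q Q'], where the coordinates along [Q'] vanish. *)
Lemma complement_quad p r (Q : 'M[R]_(p + r, p)) (Q' : 'M[R]_(p + r, r))
    (w : 'cV[R]_(p + r)) :
  (row_mx Q Q')^T *m row_mx Q Q' = 1%:M -> Q'^T *m w = 0 ->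
  (Q^T *m w)^T *m (Q^T *m w) = w^T *m w.
Proof.
move=> /mulmx1C ON Q'w; rewrite -[RHS](isometry_quad (Q := (row_mx Q Q')^T)).
  by rewrite tr_row_mx mul_col_mx Q'w tr_col_mx mul_row_col mulmx0 addr0.
by rewrite trmxK.
Qed.

Lemma principal_angle_superspace_le k r n (A : Gr R k n)
    (B X : Gr R (k + r) n) i :
  (A <= X)%VS -> (i < k)%N ->
  0 <= principal_angle A B i <= principal_angle B X (i + r).
Proof.
move=> AX ik; have hA := orthonormal_basis_of_gr A.
have hB := orthonormal_basis_of_gr B; have hX := orthonormal_basis_of_gr X.
(* With [B] as second argument in both angles, both Gram matrices act on coordinates with respect to
   [gr_basis B], so [J] can be the identity. *)
rewrite (principal_angle_sym B); last by lia.
apply: (principal_angle_le hA hB hX hB); try lia.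
have [Q [-> QQ]] := orthonormal_basis_sub hA hX AX.
have [Q' ON] := orthonormal_completion QQ.
set M := (gr_basis X)^T *m gr_basis B.
(* The [r] equations say that [M *m c] is orthogonal to [Q'], that is, lies in the range of [Q], the
   coordinates of [A] in [X]. *)
apply: (@real_eigenvalues_interlacing R _ _ r _ _ 1%:M (Q'^T *m M));
  rewrite ?mulmx_tr_sym //; try lia.
- by move=> c _; rewrite mul1mx.
move=> c; rewrite -mulmxA => Q'Mc; rewrite mul1mx !gram_quad.
rewrite -(complement_quad ON Q'Mc).
by rewrite [(gr_basis X *m Q)^T]trmx_mul /M !mulmxA.
Qed.

(** * Adapted bases and attainment of the bounds *)

Lemma gram_eq0 m n (N : 'M[R]_(m, n)) : N^T *m N = 0 -> N = 0.
Proof.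
move=> NN; apply/matrixP => i j.
have /matrixP /(_ i 0) : col j N = 0.
  apply: tr_mul_self_eq0.
  by rewrite colE trmx_mul mulmxA -(mulmxA _ N^T) NN mulmx0 mul0mx.
by rewrite !mxE.
Qed.

Lemma kernel_unit_vector p q (C : 'M[R]_(p, q)) : (p < q)%N ->
  exists x : 'cV[R]_q, x^T *m x = 1%:M /\ C *m x = 0.
Proof.
move=> pq; have qE : q = (p + (q - p).-1.+1)%N by lia.
move: (q - p).-1 qE C => r -> C; have [Q [QQ CQ]] := kernel_isometry C.
exists (col 0 Q); split; last by rewrite colE mulmxA CQ mul0mx.
rewrite colE isometry_quad // trmx_delta mul_delta_mx.
by apply/matrixP => i j; rewrite !ord1 !mxE.
Qed.

(** The matrix [M] has rank at most [m], so it kills a unit vector in the range of [V], which has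
    [i + 1 > m] columns. *)
Lemma real_eigenvalues_gram_eq0 m n (M : 'M[R]_(m, n)) i :
  (m <= i)%N -> (real_eigenvalues (M^T *m M))`_i = 0.
Proof.
move=> mi; have symM := mulmx_tr_sym M.
have [sizeS _ _] := sorted_spectral_decomposition symM.
have [lein|ltin] := leqP n i; first by rewrite nth_default // sizeS.
have [V VV VS] := real_eigenvalues_maxmin symM ltin.
have [|x [xx MVx]] := @kernel_unit_vector _ _ (M *m V); first by lia.
have x1 : (x^T *m x) 0 0 = 1 by rewrite xx mxE eqxx.
apply/le_anti; rewrite real_eigenvalues_gram_ge0 andbT.
have := VS x; rewrite x1 mulr1 gram_quad (mulmxA M V x) MVx.
by rewrite mulmx0 mxE.
Qed.

(** The columns of [B *m P] are right singular vectors of [A^T *m B]. As this matrix has [k] rows,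
    the last [r] eigenvalues of its Gram matrix vanish, which puts [B2] in the kernel of [A^T]. *)
Lemma adapted_basis k r n (A : 'M[R]_(n, k)) (W : {vspace 'cV[R]_n})
    (B : 'M[R]_(n, k + r))
    (s := real_eigenvalues ((A^T *m B)^T *m (A^T *m B))) :
  orthonormal_basis W B ->
  exists (B1 : 'M[R]_(n, k)) (B2 : 'M[R]_(n, r)),
    [/\ orthonormal_basis W (row_mx B1 B2), A^T *m B2 = 0 &
        (A^T *m B1)^T *m (A^T *m B1) = diag_mx (\row_i s`_i)].
Proof.
move=> WB; have [sizeS sortedS [P [PP PSP]]] :=
  sorted_spectral_decomposition (mulmx_tr_sym (A^T *m B)).
exists (B *m lsubmx P), (B *m rsubmx P).
have PE : row_mx (B *m lsubmx P) (B *m rsubmx P) = B *m P.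
  by rewrite -mul_mx_row hsubmxK.
have gramE : (A^T *m (B *m P))^T *m (A^T *m (B *m P)) = diag_mx (\row_i s`_i).
  by rewrite -PSP !trmx_mul !trmxK !mulmxA.
move: gramE; rewrite -PE mul_mx_row tr_row_mx mul_col_row.
rewrite -[X in diag_mx X]hsubmxK diag_mx_row => /eq_block_mx[E1 _ _ E2].
split.
- by rewrite PE; apply: orthonormal_basis_rotate.
- apply: gram_eq0; rewrite E2; apply/matrixP => i j; rewrite !mxE.
  by rewrite real_eigenvalues_gram_eq0 ?mul0rn //= leq_addr.
- by rewrite E1; congr diag_mx; apply/rowP => i; rewrite !mxE.
Qed.

Lemma real_eigenvalues_diag n (d : 'rV[R]_n) (s : seq R) :
  sorted >=%R s -> perm_eq s [seq d 0 i | i : 'I_n] ->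
  real_eigenvalues (diag_mx d) = s.
Proof.
move=> s_sorted s_perm; rewrite (real_eigenvalues_char_poly (r := s)).
  by apply: sorted_sort => // x y z /= yx xz; apply: le_trans yx.
rewrite (perm_big _ s_perm) big_map big_enum /=.
rewrite char_poly_trig ?diag_mx_is_trig //.
by apply: eq_bigr => i _; rewrite mxE eqxx.
Qed.

(** Sorting moves the ones to the front because no entry of [s] exceeds 1; this is the source of the
    index shift by [r]. *)
Lemma real_eigenvalues_block_diag1 k r (s : seq R) :
  sorted >=%R s -> size s = k -> all (<= 1) s ->
  real_eigenvalues (diag_mx (row_mx (\row_(i < k) s`_i) (const_mx 1 : 'rV_r))) =
  nseq r 1 ++ s.
Proof.
move=> s_sorted sizes s1; apply: real_eigenvalues_diag.
  have ge_trans : transitive (>=%R : rel R).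
    by move=> x y z /= yx xz; apply: le_trans yx.
  rewrite sorted_pairwise // pairwise_cat -!sorted_pairwise // s_sorted andbT.
  apply/andP; split.
    by apply/allrelP => x y /nseqP[-> _] /(allP s1).
  by elim: r => // -[|r] //= ->; rewrite lexx.
suff -> : [seq row_mx (\row_(i < k) s`_i) (const_mx 1 : 'rV_r) 0 i
          | i : 'I_(k + r)] = s ++ nseq r 1 by rewrite perm_catC.
apply: (@eq_from_nth _ 0) => [|i].
  by rewrite size_map size_enum_ord size_cat size_nseq sizes.
rewrite size_map size_enum_ord => ikr.
rewrite (nth_map (Ordinal ikr)) ?size_enum_ord // nth_cat sizes mxE.
rewrite nth_nseq; case: splitP; rewrite nth_enum_ord // => j ij.
  by rewrite mxE ij ltn_ord.
by rewrite mxE ij ltnNge leq_addr addKn ltn_ord.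
Qed.

Lemma subspace_attained k r n (A : Gr R k n) (B : Gr R (k + r) n) :
  exists2 Y : Gr R k n, (Y <= B)%VS &
    forall i, (i < k)%N -> principal_angle A Y i = principal_angle A B i.
Proof.
have hA := orthonormal_basis_of_gr A; have hB := orthonormal_basis_of_gr B.
have [B1 [B2 [hB12 AB2 gramB1]]] := adapted_basis (gr_basis A) hB.
set s := real_eigenvalues _ in gramB1.
have [sizeS sortedS _] :=
  sorted_spectral_decomposition (mulmx_tr_sym ((gr_basis A)^T *m gr_basis B)).
(* Writing [B1] as a product with a selection matrix makes the inclusion of spans an instance of
   [span_cols_mulmx]. *)
have B1E : B1 = row_mx B1 B2 *m col_mx 1%:M 0.
  by rewrite mul_row_col mulmx1 mulmx0 addr0.
have [BB _] := hB12.
have [B1B1 _ _ _] := orthonormal_row_mx BB.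
have [Y hY] := orthonormal_basis_span B1B1.
exists Y => [|i ik].
  by case: hY => _ <-; case: hB12 => _ <-; rewrite {1}B1E span_cols_mulmx.
rewrite (principal_angle_eigenvalues hA hY); last by lia.
rewrite (principal_angle_eigenvalues hA hB); last by lia.
rewrite gramB1 (@real_eigenvalues_diag _ _ (take k s)) ?nth_take //.
  exact: take_sorted.
have -> : take k s = [seq s`_i | i : 'I_k].
  apply: (@eq_from_nth _ 0).
    by rewrite size_takel ?sizeS ?leq_addr // size_map size_enum_ord.
  move=> j; rewrite size_takel ?sizeS ?leq_addr // => jk.
  by rewrite nth_take // (nth_map (Ordinal jk)) ?size_enum_ord // nth_enum_ord.
by under [X in perm_eq _ X]eq_map do rewrite mxE.
Qed.

Lemma superspace_attained k r n (A : Gr R k n) (B : Gr R (k + r) n) :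
  exists2 X : Gr R (k + r) n, (A <= X)%VS &
    (forall i, (i < k)%N ->
       principal_angle B X (i + r) = principal_angle A B i) /\
    (forall i, (i < r)%N -> principal_angle B X i = 0).
Proof.
have hA := orthonormal_basis_of_gr A; have hB := orthonormal_basis_of_gr B.
have [B1 [B2 [hB12 AB2 gramB1]]] := adapted_basis (gr_basis A) hB.
set s := real_eigenvalues _ in gramB1.
have [sizeS sortedS _] :=
  sorted_spectral_decomposition (mulmx_tr_sym ((gr_basis A)^T *m gr_basis B)).
have [BB _] := hB12; have [AA AS] := hA; have [BB0 _] := hB.
have [_ _ B2B1 B2B2] := orthonormal_row_mx BB.
have B2A : B2^T *m gr_basis A = 0.
  by rewrite -[LHS]trmxK trmx_mul trmxK AB2 trmx0.
have XX : (row_mx (gr_basis A) B2)^T *m row_mx (gr_basis A) B2 = 1%:M.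
  by rewrite tr_row_mx mul_col_row AA AB2 B2A B2B2 -scalar_mx_block.
have [X hX] := orthonormal_basis_span XX.
(* The blocks [A^T *m B2] and [B2^T *m B1] vanish and [B2^T *m B2] is the identity, which yields [r]
   singular values 1, that is, [r] zero angles. *)
have gramX : ((row_mx (gr_basis A) B2)^T *m row_mx B1 B2)^T *m
    ((row_mx (gr_basis A) B2)^T *m row_mx B1 B2) =
    diag_mx (row_mx (\row_(i < k) (take k s)`_i) (const_mx 1 : 'rV_r)).
  rewrite tr_row_mx mul_col_row AB2 B2B1 B2B2 tr_block_mx mulmx_block.
  rewrite !trmx0 trmx1 !mulmx0 !mul0mx !addr0 !add0r mulmx1 gramB1 diag_mx_row.
  congr block_mx; last by rewrite diag_const_mx.
  by congr diag_mx; apply/rowP => i; rewrite !mxE nth_take.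
have eigX := congr1 (@real_eigenvalues R (k + r)) gramX.
rewrite real_eigenvalues_block_diag1 in eigX; last 3 first.
- exact: take_sorted.
- by rewrite size_takel // sizeS leq_addr.
- apply/(all_nthP 0) => i; rewrite size_takel ?sizeS ?leq_addr // => ik.
  by rewrite /= nth_take //; apply: real_eigenvalues_orthonormal_le1.
exists X; [|split=> i ilt].
- case: hX => _ <-; rewrite -AS.
  have {1}-> : gr_basis A = row_mx (gr_basis A) B2 *m col_mx 1%:M 0.
    by rewrite mul_row_col mulmx1 mulmx0 addr0.
  exact: span_cols_mulmx.
- rewrite principal_angle_sym; last by lia.
  rewrite (principal_angle_eigenvalues hX hB12); last by lia.
  rewrite (principal_angle_eigenvalues hA hB); last by lia.
  by rewrite eigX nth_cat size_nseq ltnNge leq_addl /= addnK nth_take.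
- rewrite principal_angle_sym; last by lia.
  rewrite (principal_angle_eigenvalues hX hB12); last by lia.
  by rewrite eigX nth_cat size_nseq ilt nth_nseq ilt sqrtr1 acos1.
Qed.

(** * Distances to the Schubert varieties *)

Lemma gr_dist_set_attained (d : gr_metric) k n (V : Gr R k n)
    (S : set (Gr R k n)) W :
  S W -> (forall W', S W' -> gr_dist d V W <= gr_dist d V W')%E ->
  gr_dist_set d V S = gr_dist d V W.
Proof.
move=> SW minW; apply/le_anti/andP; split.
  by apply: ereal_inf_lbound; exists W.
by apply: le_ereal_inf_tmp => _ [W' SW' <-]; apply: minW.
Qed.

Lemma gr_dist_set_Omega_minus (d : gr_metric) k r n (A : Gr R k n)
    (B : Gr R (k + r) n) : (0 < k)%N ->
  gr_dist_set d A (Omega_minus B) = of_angles d k (principal_angle A B).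
Proof.
move=> k0; have [Y YB angleY] := subspace_attained A B.
have distY : gr_dist d A Y = of_angles d k (principal_angle A B).
  rewrite /gr_dist -{1}[k]addn0; apply: of_angles_eq => // i ik.
  by rewrite addn0 angleY.
rewrite -distY; apply: gr_dist_set_attained => // Y' Y'B.
rewrite distY /gr_dist -[X in of_angles d X (principal_angle A Y')]addn0.
apply: of_angles_le => // i ik.
  by rewrite addn0; apply: principal_angle_subspace_le.
by rewrite addn0 in ik; apply: principal_angle_itv; lia.
Qed.

Lemma gr_dist_set_Omega_plus (d : gr_metric) k r n (A : Gr R k n)
    (B : Gr R (k + r) n) : (0 < k)%N ->
  gr_dist_set d B (Omega_plus A) = of_angles d k (principal_angle A B).
Proof.
move=> k0; have [X AX [angleX angleX0]] := superspace_attained A B.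
have distX : gr_dist d B X = of_angles d k (principal_angle A B).
  exact: of_angles_eq.
rewrite -distX; apply: gr_dist_set_attained => // X' AX'.
rewrite distX; apply: of_angles_le => // i ik.
  by apply: principal_angle_superspace_le.
by apply: principal_angle_itv; lia.
Qed.

End PrincipalAngles.

Theorem theorem12 (R : realType) (k l n : nat)
    (hk : (0 < k)%N) (hl : (0 < l)%N) (hkn : (k <= n)%N) (hln : (l <= n)%N)
    (A : Gr R k n) (B : Gr R l n) (d : gr_metric) :
  ((k <= l)%N ->
     gr_dist_set d A (Omega_minus B) = gr_dist_set d B (Omega_plus A) /\
     gr_dist_set d A (Omega_minus B) = of_angles d k (principal_angle A B)) /\
  ((l < k)%N ->
     gr_dist_set d B (Omega_minus A) = gr_dist_set d A (Omega_plus B) /\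
     gr_dist_set d B (Omega_minus A) =
       of_angles d (minn k l) (principal_angle A B)).
Proof.
split=> [kl|lk].
  (* The dimension [l] is put in the form [k + (l - k)] expected by the two distance formulas. *)
  move: B; rewrite -(subnKC kl) => B.
  by rewrite gr_dist_set_Omega_plus // gr_dist_set_Omega_minus.
have le_lk := ltnW lk; move: A; rewrite (minn_idPr le_lk) -(subnKC le_lk) => A.
rewrite gr_dist_set_Omega_plus // gr_dist_set_Omega_minus //; split=> //.
(* The angles of (B, A) and (A, B) are known to agree only below [l], hence the transport with
   [r = 0]. *)
rewrite -[LHS](@of_angles_eq _ d l 0 _ (principal_angle A B)) ?addn0 // => i il.
by rewrite addn0 principal_angle_sym //; lia.
Qed.
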